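(* Let $\alpha,\beta,\gamma,\delta\in\mathbb{R}$ with $\alpha+\delta\neq0$ and $\alpha\gamma+\beta\delta=0$, and let $G_5$ be the connected, simply connected three-dimensional Lie group with left-invariant Lorentzian metric $g$ whose Lie algebra has a pseudo-orthonormal basis $\{\widetilde e_1,\widetilde e_2,\widetilde e_3\}$, with $\widetilde e_3$ timelike, satisfying $$[\widetilde e_1,\widetilde e_2]=0,\quad [\widetilde e_1,\widetilde e_3]=\alpha\widetilde e_1+\beta\widetilde e_2,\quad [\widetilde e_2,\widetilde e_3]=\gamma\widetilde e_1+\delta\widetilde e_2.$$ Then the symmetrized Ricci tensor $\widetilde\rho^B$ of the Bott connection $\nabla^B$ is a Codazzi tensor on $(G_5,\nabla^B)$.
   Context: Basis vectors are identified with left-invariant vector fields on the group $G$; $g(\widetilde e_1,\widetilde e_1)=g(\widetilde e_2,\widetilde e_2)=1$, $g(\widetilde e_3,\widetilde e_3)=-1$, and $g(\widetilde e_i,\widetilde e_j)=0$ for $i\ne j$. Let $\nabla^L$ be the Levi-Civita connection of $g$, $D=\mathrm{span}\{\widetilde e_1,\widetilde e_2\}$, $D^\perp=\mathrm{span}\{\widetilde e_3\}$ (distributions on $G$), with associated projections $\pi_D,\pi_{D^\perp}$ of $TG=D\oplus D^\perp$. The Bott connection $\nabla^B$ is the linear connection given by: $\nabla^B_XY=\pi_D(\nabla^L_XY)$ for $X,Y\in\Gamma^\infty(D)$; $\nabla^B_XY=\pi_D([X,Y])$ for $X\in\Gamma^\infty(D^\perp),Y\in\Gamma^\infty(D)$;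 $\nabla^B_XY=\pi_{D^\perp}([X,Y])$ for $X\in\Gamma^\infty(D),Y\in\Gamma^\infty(D^\perp)$; $\nabla^B_XY=\pi_{D^\perp}(\nabla^L_XY)$ for $X,Y\in\Gamma^\infty(D^\perp)$. Curvature: $R^B(X,Y)Z=\nabla^B_X\nabla^B_YZ-\nabla^B_Y\nabla^B_XZ-\nabla^B_{[X,Y]}Z$. Ricci tensor: $\rho^B(X,Y)=-g(R^B(X,\widetilde e_1)Y,\widetilde e_1)-g(R^B(X,\widetilde e_2)Y,\widetilde e_2)+g(R^B(X,\widetilde e_3)Y,\widetilde e_3)$. Symmetrized Ricci tensor: $\widetilde\rho^B(X,Y)=\tfrac12(\rho^B(X,Y)+\rho^B(Y,X))$. For a linear connection $\nabla$ and a $(0,2)$ tensor field $\omega$: $(\nabla_X\omega)(Y,Z)=X[\omega(Y,Z)]-\omega(\nabla_XY,Z)-\omega(Y,\nabla_XZ)$. The tensor $\omega$ is called a Codazzi tensor on $(G,\nabla)$ if $(\nabla_X\omega)(Y,Z)-(\nabla_Y\omega)(X,Z)=0$ for all vector fields $X,Y,Z$. *)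

(* Defs.v *)
From HB Require Import structures.
From mathcomp Require Import all_boot all_order all_algebra.
From mathcomp Require Import all_classical all_reals all_analysis.
From mathcomp Require Import ring.

Set Implicit Arguments.
Unset Strict Implicit.
Unset Printing Implicit Defensive.

Import Order.TTheory GRing.Theory Num.Theory.
Import numFieldNormedType.Exports.

Local Open Scope classical_set_scope.
Local Open Scope ring_scope.

(* Meaningful for open [U] only: derivatives at points of [U] depend on the
   values of [f] near these points. *)
Fixpoint Ck_on (R : realType) (n k : nat) (U : set 'rV[R]_n)
    (f : 'rV[R]_n -> R) : Prop :=
  match k with
  | 0 => forall x, U x -> {for x, continuous f}
  | k'.+1 => (forall x, U x -> differentiable f x) /\
             (forall i : 'I_n, Ck_on k' U ('D_(delta_mx 0 i) f))
  end.

Definition smooth_on (R : realType) (n : nat) (U : set 'rV[R]_n)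
    (f : 'rV[R]_n -> R) : Prop :=
  forall k, Ck_on k U f.

Definition smooth_map_on (R : realType) (m n : nat) (U : set 'rV[R]_m)
    (F : 'rV[R]_m -> 'rV[R]_n) : Prop :=
  forall j : 'I_n, smooth_on U (fun x => F x 0 j).

(* [cmap] is relevant on [cdom] only, and [cinv] on [cmap @` cdom] only. *)
Record chart (R : realType) (n : nat) (M : Type) := Chart {
  cdom : set M ;
  cmap : M -> 'rV[R]_n ;
  cinv : 'rV[R]_n -> M }.

Definition is_chart (R : realType) (n : nat) (M : topologicalType)
    (c : chart R n M) : Prop :=
  [/\ open (cdom c) /\ open (cmap c @` cdom c),
      forall p, cdom c p -> cinv c (cmap c p) = p,
      forall p, cdom c p -> {for p, continuous (cmap c)} &
      forall x, (cmap c @` cdom c) x -> {for x, continuous (cinv c)}].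

Definition chart_compatible (R : realType) (n : nat) (M : Type)
    (c d : chart R n M) : Prop :=
  smooth_map_on (cmap c @` (cdom c `&` cdom d)) (cmap d \o cinv c).

HB.mixin Record isManifold (R : realType) (n : nat) M & Topological M := {
  atlas : set (chart R n M) ;
  atlas_chart : forall c, atlas c -> is_chart c ;
  atlas_cover : forall p : M, exists2 c, atlas c & cdom c p ;
  atlas_compatible : forall c d, atlas c -> atlas d -> chart_compatible c d ;
  manifold_hausdorff : hausdorff_space M ;
  manifold_second_countable : @second_countable M }.

#[short(type="manifoldType")]
HB.structure Definition Manifold (R : realType) (n : nat) :=
  { M of Topological M & isManifold R n M }.

Definition smooth_map_wrt (R : realType) (m n : nat) (M N : topologicalType)
    (A : set (chart R m M)) (B : set (chart R n N)) (F : M -> N) : Prop :=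
  continuous F /\
  forall c d, A c -> B d ->
    smooth_map_on (cmap c @` (cdom c `&` F @^-1` cdom d))
                  (cmap d \o F \o cinv c).

Definition prod_chart (R : realType) (m n : nat) (M N : Type)
    (c : chart R m M) (d : chart R n N) : chart R (m + n) (M * N) :=
  {| cdom := cdom c `*` cdom d ;
     cmap := fun p => row_mx (cmap c p.1) (cmap d p.2) ;
     cinv := fun x => (cinv c (lsubmx x), cinv d (rsubmx x)) |}.

Definition prod_atlas (R : realType) (m n : nat) (M N : Type)
    (A : set (chart R m M)) (B : set (chart R n N)) :
    set (chart R (m + n) (M * N)) :=
  [set prod_chart c d | c in A & d in B].

HB.mixin Record isLieGroup (R : realType) (n : nat) G
    & Manifold R n G & monoid.Group G := {
  lie_mul_smooth :
    smooth_map_wrt (prod_atlas (@atlas R n G) (@atlas R n G)) (@atlas R n G)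
      (fun p : G * G => (p.1 * p.2)%g) ;
  lie_inv_smooth :
    smooth_map_wrt (@atlas R n G) (@atlas R n G) (fun x : G => (x^-1)%g) }.

#[short(type="lieGroupType")]
HB.structure Definition LieGroup (R : realType) (n : nat) :=
  { G of Manifold R n G & monoid.Group G & isLieGroup R n G }.

Definition simply_connected (R : realType) (T : topologicalType) : Prop :=
  (forall x y : T, exists gam : R -> T,
     [/\ {within `[0, 1], continuous gam}, gam 0 = x & gam 1 = y]) /\
  (forall gam : R -> T, {within `[0, 1], continuous gam} -> gam 0 = gam 1 ->
     exists H : R * R -> T,
     [/\ {within `[0, 1] `*` `[0, 1], continuous H},
         forall s : R, s \in `[0, 1] -> H (s, 0) = gam s,
         forall s : R, s \in `[0, 1] -> H (s, 1) = gam 0 &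
         forall t : R, t \in `[0, 1] -> H (0, t) = gam 0 /\ H (1, t) = gam 0]).

Lemma differentiable_near (R : numFieldType) (V W : normedModType R)
    (f h : V -> W) (x : V) :
  (\near x, f x = h x) -> differentiable f x -> differentiable h x.
Proof.
move=> fh /diff_locallyP [cdf /eqaddoP dfE].
have fhx : f x = h x by exact: nbhs_singleton fh.
have hE : h \o shift x = cst (h x) + 'd f x +o_ 0 id.
  apply/eqaddoP => _/posnumP[eps]; have dfEe := dfE _ (gt0 eps).
  have fh0 : \forall y \near (0 : V), f (y + x) = h (y + x).
    have sx : (fun y : V => y + x) @ 0 --> x.
      by rewrite -{2}[x]add0r; apply: cvgD; [exact: cvg_id|exact: cvg_cst].
    exact: (sx _ fh).
  near=> y.
  have fhy : f (y + x) = h (y + x) by near: y.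
  have : `|(f \o shift x - (cst (f x) + 'd f x)) y| <= eps%:num * `|id y|.
    by near: y; exact: dfEe.
  by rewrite !(addrfctE, opprfctE) /= fhy fhx.
apply/diff_locallyP.
have dE : 'd h x = 'd f x :> (V -> W) by exact: diff_unique.
by rewrite dE.
Unshelve. all: by end_near. Qed.

Section Ck_closure.
Variables (R : realType) (n : nat) (U : set 'rV[R]_n).
Hypothesis openU : open U.
Implicit Types f h : 'rV[R]_n -> R.

Lemma near_open f h x :
  (forall y, U y -> f y = h y) -> U x -> \forall y \near x, f y = h y.
Proof. by move=> fh Ux; apply: filterS fh _; exact: open_nbhs_nbhs. Qed.

Lemma Ck_on_ext k f h :
  (forall x, U x -> f x = h x) -> Ck_on k U f -> Ck_on k U h.
Proof.
elim: k f h => [|k IH] f h fh /=.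
  move=> cf x Ux; suff : h @ x --> h x by [].
  rewrite -(fh x Ux); apply: cvg_trans (cf x Ux).
  exact: near_eq_cvg (near_open fh Ux).
move=> [df dk]; split=> [x Ux|i].
  exact: differentiable_near (near_open fh Ux) (df x Ux).
apply: IH (dk i) => x Ux; apply: near_eq_derive; exact: near_open.
Qed.

Lemma Ck_on_cst k (a : R) : Ck_on k U (cst a).
Proof.
elim: k a => [|k IH] a /=; first by move=> x _; exact: cst_continuous.
split=> [x _|i]; first exact: differentiable_cst.
by apply: Ck_on_ext (IH 0) => x _; rewrite derive_cst.
Qed.

Lemma Ck_onW k f : Ck_on k.+1 U f -> Ck_on k U f.
Proof.
elim: k f => [|k IH] f [df dk].
  by move=> x Ux; exact/differentiable_continuous/df.
by split=> // i; exact/IH/dk.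
Qed.

Lemma Ck_onD k f h : Ck_on k U f -> Ck_on k U h -> Ck_on k U (f + h).
Proof.
elim: k f h => [|k IH] f h /=.
  by move=> cf ch x Ux; exact: (cvgD (cf x Ux) (ch x Ux)).
move=> [df dfk] [dh dhk]; split=> [x Ux|i].
  by apply: differentiableD; [exact: df|exact: dh].
apply: Ck_on_ext (IH _ _ (dfk i) (dhk i)) => x Ux.
by rewrite deriveD//; apply: diff_derivable; [exact: df|exact: dh].
Qed.

Lemma Ck_onM k f h : Ck_on k U f -> Ck_on k U h -> Ck_on k U (f * h).
Proof.
elim: k f h => [|k IH] f h.
  by move=> cf ch x Ux; exact: (cvgM (cf x Ux) (ch x Ux)).
move=> Cf Ch; have [[df dfk] [dh dhk]] := (Cf, Ch); split=> [x Ux|i].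
  by apply: differentiableM; [exact: df|exact: dh].
have := Ck_onD (IH _ _ (Ck_onW Cf) (dhk i)) (IH _ _ (Ck_onW Ch) (dfk i)).
apply: Ck_on_ext => x Ux.
by rewrite deriveM//; apply: diff_derivable; [exact: df|exact: dh].
Qed.

End Ck_closure.

Definition smooth_fun (R : realType) (n : nat) (M : manifoldType R n)
    (f : M -> R) : Prop :=
  forall c, @atlas R n M c -> smooth_on (cmap c @` cdom c) (f \o cinv c).

Definition smooth_pred (R : realType) (n : nat) (M : manifoldType R n) :
    {pred M -> R} := [pred f | `[< smooth_fun f >]].

Record Cinf (R : realType) (n : nat) (M : manifoldType R n) := MkCinf {
  cinf_fun :> M -> R ;
  cinf_smooth : cinf_fun \in @smooth_pred R n M }.

HB.instance Definition _ (R : realType) (n : nat) (M : manifoldType R n) :=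
  [isSub of Cinf M for @cinf_fun R n M].
HB.instance Definition _ (R : realType) (n : nat) (M : manifoldType R n) :=
  [Choice of Cinf M by <:].

Section smooth_closed.
Variables (R : realType) (n : nat) (M : manifoldType R n).

Lemma smooth_cst (a : R) : cst a \in @smooth_pred R n M.
Proof.
by apply/asboolP => c Ac k; have [[_ oU] _ _ _] := atlas_chart _ Ac; exact: Ck_on_cst.
Qed.

Lemma smoothD (f h : M -> R) : f \in @smooth_pred R n M ->
  h \in @smooth_pred R n M -> f + h \in @smooth_pred R n M.
Proof.
move=> /asboolP sf /asboolP sh; apply/asboolP => c Ac k.
have [[_ oU] _ _ _] := atlas_chart _ Ac.
by apply: (Ck_onD oU (sf c Ac k) (sh c Ac k)).
Qed.

Lemma smoothM (f h : M -> R) : f \in @smooth_pred R n M ->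
  h \in @smooth_pred R n M -> f * h \in @smooth_pred R n M.
Proof.
move=> /asboolP sf /asboolP sh; apply/asboolP => c Ac k.
have [[_ oU] _ _ _] := atlas_chart _ Ac.
by apply: (Ck_onM oU (sf c Ac k) (sh c Ac k)).
Qed.

Lemma smoothZ (a : R) (f : M -> R) :
  f \in @smooth_pred R n M -> a *: f \in @smooth_pred R n M.
Proof. by move=> sf; exact: smoothM (smooth_cst a) sf. Qed.

Lemma smooth_subring_closed : subring_closed (@smooth_pred R n M).
Proof.
split; [exact: smooth_cst| |exact: smoothM].
move=> f h sf sh; apply: smoothD => //.
by rewrite -scaleN1r; exact: smoothZ.
Qed.

Lemma smooth_submod_closed :
  GRing.subsemimod_closed (@smooth_pred R n M).
Proof.
split; last by move=> a f; exact: smoothZ.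
by split; [exact: smooth_cst|exact: smoothD].
Qed.

End smooth_closed.

HB.instance Definition _ (R : realType) (n : nat) (M : manifoldType R n) :=
  GRing.SubChoice_isSubComPzRing.Build (M -> R) (@smooth_pred R n M) (Cinf M)
    (@smooth_subring_closed R n M).
HB.instance Definition _ (R : realType) (n : nat) (M : manifoldType R n) :=
  GRing.SubZmodule_isSubLmodule.Build R (M -> R) (@smooth_pred R n M) (Cinf M)
    (@smooth_submod_closed R n M).

(* Vector fields are encoded as the R-linear derivations of C^oo(M), so that
   the Lie bracket is the commutator. *)
Record vfield (R : realType) (n : nat) (M : manifoldType R n) := MkVfield {
  vf_fun :> Cinf M -> Cinf M ;
  vf_linear : forall (a : R) (f h : Cinf M),
    vf_fun (a *: f + h) = a *: vf_fun f + vf_fun h ;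
  vf_leibniz : forall f h : Cinf M, vf_fun (f * h) = vf_fun f * h + f * vf_fun h }.

HB.instance Definition _ (R : realType) (n : nat) (M : manifoldType R n) :=
  gen_eqMixin (vfield M).
HB.instance Definition _ (R : realType) (n : nat) (M : manifoldType R n) :=
  gen_choiceMixin (vfield M).

Section vfield_module.
Variables (R : realType) (n : nat) (M : manifoldType R n).
Implicit Types (X Y Z : vfield M) (u f h : Cinf M).

Lemma vfieldP X Y : (forall f, X f = Y f) -> X = Y.
Proof.
case: X Y => [X X1 X2] [Y Y1 Y2] /= /funext XY.
by case: Y / XY Y1 Y2 => Y1 Y2; congr MkVfield; exact: Prop_irrelevance.
Qed.

Lemma scaleCl (a : R) u f : a *: (u * f) = (a *: u) * f.
Proof. by apply/val_inj/funext => p; exact: mulrA. Qed.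

Lemma scaleCr (a : R) u f : a *: (u * f) = u * (a *: f).
Proof. by rewrite mulrC scaleCl mulrC. Qed.

Lemma vf0_linear (a : R) f h : (0 : Cinf M) = a *: 0 + 0.
Proof. by rewrite scaler0 addr0. Qed.

Lemma vf0_leibniz f h : (0 : Cinf M) = 0 * h + f * 0.
Proof. by rewrite mul0r mulr0 addr0. Qed.

Definition vf0 : vfield M := MkVfield vf0_linear vf0_leibniz.

Lemma vfD_linear X Y (a : R) f h :
  X (a *: f + h) + Y (a *: f + h) = a *: (X f + Y f) + (X h + Y h).
Proof. by rewrite !vf_linear scalerDr addrACA. Qed.

Lemma vfD_leibniz X Y f h :
  X (f * h) + Y (f * h) = (X f + Y f) * h + f * (X h + Y h).
Proof. by rewrite !vf_leibniz mulrDl mulrDr addrACA. Qed.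

Definition vfD X Y : vfield M := MkVfield (vfD_linear X Y) (vfD_leibniz X Y).

Lemma vfN_linear X (a : R) f h :
  - X (a *: f + h) = a *: - X f + - X h.
Proof. by rewrite vf_linear opprD scalerN. Qed.

Lemma vfN_leibniz X f h : - X (f * h) = (- X f) * h + f * - X h.
Proof. by rewrite vf_leibniz opprD mulNr mulrN. Qed.

Definition vfN X : vfield M := MkVfield (vfN_linear X) (vfN_leibniz X).

Lemma vfZ_linear u X (a : R) f h :
  u * X (a *: f + h) = a *: (u * X f) + u * X h.
Proof. by rewrite vf_linear mulrDr scaleCr. Qed.

Lemma vfZ_leibniz u X f h : u * X (f * h) = u * X f * h + f * (u * X h).
Proof. by rewrite vf_leibniz mulrDr mulrA (mulrCA u f). Qed.

Definition vfZ u X : vfield M := MkVfield (vfZ_linear u X) (vfZ_leibniz u X).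

Lemma vfDA : associative vfD.
Proof. by move=> X Y Z; apply: vfieldP => f /=; rewrite addrA. Qed.

Lemma vfDC : commutative vfD.
Proof. by move=> X Y; apply: vfieldP => f /=; rewrite addrC. Qed.

Lemma vf0D : left_id vf0 vfD.
Proof. by move=> X; apply: vfieldP => f /=; rewrite add0r. Qed.

Lemma vfND : left_inverse vf0 vfN vfD.
Proof. by move=> X; apply: vfieldP => f /=; rewrite addNr. Qed.

HB.instance Definition _ :=
  GRing.isZmodule.Build (vfield M) vfDA vfDC vf0D vfND.

Lemma vfZA u f X : vfZ u (vfZ f X) = vfZ (u * f) X.
Proof. by apply: vfieldP => h /=; rewrite mulrA. Qed.

Lemma vf1Z : left_id 1 vfZ.
Proof. by move=> X; apply: vfieldP => f /=; rewrite mul1r. Qed.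

Lemma vfZDr : right_distributive vfZ +%R.
Proof. by move=> u X Y; apply: vfieldP => f /=; rewrite mulrDr. Qed.

Lemma vfZDl X : {morph vfZ^~ X : u f / u + f}.
Proof. by move=> u f; apply: vfieldP => h /=; rewrite mulrDl. Qed.

HB.instance Definition _ :=
  GRing.Zmodule_isLmodule.Build (Cinf M) (vfield M) vfZA vf1Z vfZDr vfZDl.

Lemma lie_linear X Y (a : R) f h :
  X (Y (a *: f + h)) - Y (X (a *: f + h)) =
  a *: (X (Y f) - Y (X f)) + (X (Y h) - Y (X h)).
Proof. by rewrite !vf_linear scalerBr opprD addrACA. Qed.

Lemma lie_leibniz X Y f h :
  X (Y (f * h)) - Y (X (f * h)) =
  (X (Y f) - Y (X f)) * h + f * (X (Y h) - Y (X h)).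
Proof.
have vfadd Z u v : Z (u + v) = Z u + Z v.
  by rewrite -[u]scale1r vf_linear !scale1r.
rewrite !vf_leibniz !vfadd !vf_leibniz; ring.
Qed.

Definition lie X Y : vfield M := MkVfield (lie_linear X Y) (lie_leibniz X Y).

End vfield_module.

(* A tangent vector at [p] is an R-linear derivation at [p] of C^oo(M). *)
Definition tangent_vector (R : realType) (n : nat) (M : manifoldType R n)
    (p : M) (v : Cinf M -> R) : Prop :=
  (forall (a : R) (f h : Cinf M), v (a *: f + h) = a * v f + v h) /\
  (forall f h : Cinf M, v (f * h) = v f * h p + f p * v h).

(* The values at [p] of the vector fields [E i] form a basis of T_p M. *)
Definition basis_at (R : realType) (n k : nat) (M : manifoldType R n)
    (p : M) (E : 'I_k -> vfield M) : Prop :=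
  forall v : Cinf M -> R, tangent_vector p v ->
    exists! c : 'rV[R]_k, forall f : Cinf M, v f = \sum_(i < k) c 0 i * E i f p.

Definition cst_fun (R : realType) (n : nat) (M : manifoldType R n) (a : R) :
    Cinf M := a *: (1 : Cinf M).

(* Tensor fields of type (0,2) are the C^oo(M)-bilinear maps on vector
   fields. *)
Definition tensor02 (R : realType) (n : nat) (M : manifoldType R n)
    (w : vfield M -> vfield M -> Cinf M) : Prop :=
  (forall (u : Cinf M) (X X' Y : vfield M),
     w (u *: X + X') Y = u * w X Y + w X' Y) /\
  (forall (u : Cinf M) (X Y Y' : vfield M),
     w X (u *: Y + Y') = u * w X Y + w X Y').

(* Signature (+, ..., +, -). *)
Definition lorentzian_metric (R : realType) (n : nat) (M : manifoldType R n)
    (g : vfield M -> vfield M -> Cinf M) : Prop :=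
  [/\ tensor02 g,
      forall X Y, g X Y = g Y X &
      forall p : M, exists E : 'I_n -> vfield M, basis_at p E /\
        forall i j, g (E i) (E j) p =
          if i == j then (if i.+1 == n then -1 else 1) else 0].

Definition affine_connection (R : realType) (n : nat) (M : manifoldType R n)
    (nabla : vfield M -> vfield M -> vfield M) : Prop :=
  [/\ forall (u : Cinf M) (X X' Y : vfield M),
        nabla (u *: X + X') Y = u *: nabla X Y + nabla X' Y,
      forall X Y Y' : vfield M, nabla X (Y + Y') = nabla X Y + nabla X Y' &
      forall (u : Cinf M) (X Y : vfield M),
        nabla X (u *: Y) = X u *: Y + u *: nabla X Y].

(* (nabla_X w)(Y, Z). *)
Definition cov_deriv02 (R : realType) (n : nat) (M : manifoldType R n)
    (nabla : vfield M -> vfield M -> vfield M)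
    (w : vfield M -> vfield M -> Cinf M) (X Y Z : vfield M) : Cinf M :=
  X (w Y Z) - w (nabla X Y) Z - w Y (nabla X Z).

Definition levi_civita (R : realType) (n : nat) (M : manifoldType R n)
    (g : vfield M -> vfield M -> Cinf M)
    (nabla : vfield M -> vfield M -> vfield M) : Prop :=
  [/\ affine_connection nabla,
      forall X Y, nabla X Y - nabla Y X = lie X Y &
      forall X Y Z, cov_deriv02 nabla g X Y Z = 0].

Definition curvature (R : realType) (n : nat) (M : manifoldType R n)
    (nabla : vfield M -> vfield M -> vfield M) (X Y Z : vfield M) : vfield M :=
  nabla X (nabla Y Z) - nabla Y (nabla X Z) - nabla (lie X Y) Z.

Definition codazzi_tensor (R : realType) (n : nat) (M : manifoldType R n)
    (nabla : vfield M -> vfield M -> vfield M)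
    (w : vfield M -> vfield M -> Cinf M) : Prop :=
  tensor02 w /\
  forall X Y Z, cov_deriv02 nabla w X Y Z - cov_deriv02 nabla w Y X Z = 0.

(* A distribution D is represented by its C^oo(M)-module of sections. *)
Definition is_projections (R : realType) (n : nat) (M : manifoldType R n)
    (D D' : set (vfield M)) (pi pi' : vfield M -> vfield M) : Prop :=
  forall X, [/\ D (pi X), D' (pi' X) & X = pi X + pi' X].

Definition bott_connection (R : realType) (n : nat) (M : manifoldType R n)
    (nablaL : vfield M -> vfield M -> vfield M)
    (D D' : set (vfield M)) (pi pi' : vfield M -> vfield M)
    (nablaB : vfield M -> vfield M -> vfield M) : Prop :=
  [/\ affine_connection nablaB,
      forall X Y, D X -> D Y -> nablaB X Y = pi (nablaL X Y),
      forall X Y, D' X -> D Y -> nablaB X Y = pi (lie X Y),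
      forall X Y, D X -> D' Y -> nablaB X Y = pi' (lie X Y) &
      forall X Y, D' X -> D' Y -> nablaB X Y = pi' (nablaL X Y)].

Definition span1 (R : realType) (n : nat) (M : manifoldType R n)
    (e : vfield M) : set (vfield M) :=
  [set X | exists u : Cinf M, X = u *: e].

Definition span2 (R : realType) (n : nat) (M : manifoldType R n)
    (e e' : vfield M) : set (vfield M) :=
  [set X | exists u u' : Cinf M, X = u *: e + u' *: e'].

(* [X] and [X'] are related by the left translation by [a]. *)
Definition left_related (R : realType) (n : nat) (G : lieGroupType R n)
    (a : G) (X X' : vfield G) : Prop :=
  forall f fa : Cinf G, (forall x : G, fa x = f (a * x)%g) ->
    forall x : G, X fa x = X' f (a * x)%g.

Definition left_invariant (R : realType) (n : nat) (G : lieGroupType R n)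
    (X : vfield G) : Prop :=
  forall a : G, left_related a X X.

Definition left_invariant_metric (R : realType) (n : nat)
    (G : lieGroupType R n) (g : vfield G -> vfield G -> Cinf G) : Prop :=
  forall (a : G) (X X' Y Y' : vfield G),
    left_related a X X' -> left_related a Y Y' ->
    forall x : G, g X Y x = g X' Y' (a * x)%g.

(* The Lie algebra is T_1 G, a tangent vector being identified with its
   left-invariant extension. *)
Definition lie_algebra_basis (R : realType) (n : nat) (G : lieGroupType R n)
    (E : 'I_n -> vfield G) : Prop :=
  (forall i, left_invariant (E i)) /\ basis_at (1%g : G) E.

Definition frame3 (R : realType) (n : nat) (M : manifoldType R n)
    (e1 e2 e3 : vfield M) : 'I_3 -> vfield M :=
  tnth [tuple e1; e2; e3].

Definition pseudo_orthonormal (R : realType) (n : nat) (M : manifoldType R n)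
    (g : vfield M -> vfield M -> Cinf M) (e1 e2 e3 : vfield M) : Prop :=
  [/\ g e1 e1 = 1, g e2 e2 = 1 & g e3 e3 = -1] /\
  [/\ g e1 e2 = 0, g e1 e3 = 0 & g e2 e3 = 0].

Definition ricci (R : realType) (n : nat) (M : manifoldType R n)
    (g : vfield M -> vfield M -> Cinf M)
    (nabla : vfield M -> vfield M -> vfield M) (e1 e2 e3 : vfield M)
    (X Y : vfield M) : Cinf M :=
  - g (curvature nabla X e1 Y) e1 - g (curvature nabla X e2 Y) e2
  + g (curvature nabla X e3 Y) e3.

Definition sym_ricci (R : realType) (n : nat) (M : manifoldType R n)
    (g : vfield M -> vfield M -> Cinf M)
    (nabla : vfield M -> vfield M -> vfield M) (e1 e2 e3 : vfield M)
    (X Y : vfield M) : Cinf M :=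
  2^-1 *: (ricci g nabla e1 e2 e3 X Y + ricci g nabla e1 e2 e3 Y X).

(* Main.v *)
Require Import Defs.
From mathcomp Require Import all_boot all_order all_algebra.
From mathcomp Require Import all_classical all_reals all_analysis.
From mathcomp Require Import ring.

Set Implicit Arguments.
Unset Strict Implicit.
Unset Printing Implicit Defensive.

Import GRing.Theory.

Local Open Scope classical_set_scope.
Local Open Scope ring_scope.

(** The Codazzi identity holds because the Bott connection is flat, so that its
    Ricci tensor vanishes identically.

    The fields [e1] and [e2] commute and have constant inner products, so the
    Koszul formula ([koszul], [koszul_commuting]) shows that
    [nablaL (e_i) (e_j)] has no component along [D] for [i, j] in [{1, 2}].
    As [lie (e_i) e3] lies in [D], it has no component along [e3].  Hence
    [nablaB] differentiates [e1], [e2] and [e3] to zero in all directions of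
    [D], while [nablaB e3] acts on the frame as the constant matrix of
    [lie e3] on [D] and kills [e3] ([bott_frame_parallel],
    [bott_e3]).  In other words, on the left-invariant frame [nablaB] is given by a linear
    map [rho] from the Lie algebra to 3 x 3 matrices that vanishes on the
    ideal [D].  The quotient by [D] is one-dimensional, so [rho] is a
    representation of the Lie algebra, and this is what flatness means.

    On an arbitrary triple of fields the curvature is computed from the frame
    by tensoriality ([curvature_addl], [curvature_anti], [curvature_addr]);
    the frame generates all vector fields over the smooth functions because of
    the decomposition along [D] and its complement ([projections_ind]). *)

(** * Calculus of derivations, tensors and connections *)

Section Derivations.
Variables (R : realType) (n : nat) (M : manifoldType R n).
Implicit Types (X Y Z : vfield M) (u f h : Cinf M).

Lemma vf_add X f h : X (f + h) = X f + X h.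
Proof. by rewrite -[f]scale1r vf_linear !scale1r. Qed.

Lemma vf_zero X : X 0 = 0.
Proof. by apply: (addrI (X 0)); rewrite -vf_add !addr0. Qed.

Lemma vf_one X : X 1 = 0.
Proof.
apply: (addrI (X 1)).
by rewrite addr0 -{3}[1]mulr1 vf_leibniz mulr1 mul1r.
Qed.

Lemma vf_cst X (a : R) : X (cst_fun M a) = 0.
Proof.
by have := vf_linear X a 1 0; rewrite vf_zero vf_one scaler0 !addr0.
Qed.

Lemma lie_anti X Y : lie X Y = - lie Y X.
Proof. by apply: vfieldP => f /=; rewrite opprB. Qed.

Lemma lieDl X X' Y : lie (X + X') Y = lie X Y + lie X' Y.
Proof. by apply: vfieldP => f /=; rewrite vf_add; ring. Qed.

Lemma lieZl u X Y : lie (u *: X) Y = u *: lie X Y - Y u *: X.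
Proof. by apply: vfieldP => f /=; rewrite vf_leibniz; ring. Qed.

Lemma Cinf_double_eq0 f : f + f = 0 -> f = 0.
Proof.
move=> ff0; rewrite -[f]scale1r -[1](@mulVf R 2) ?Num.Theory.pnatr_eq0//.
by rewrite -scalerA mulr2n scalerDl scale1r ff0 scaler0.
Qed.

End Derivations.

Section Tensors.
Variables (R : realType) (n : nat) (M : manifoldType R n).
Variable w : vfield M -> vfield M -> Cinf M.
Hypothesis w_tensor : tensor02 w.
Implicit Types (X Y Z : vfield M) (u : Cinf M).

Lemma tensorDl X X' Y : w (X + X') Y = w X Y + w X' Y.
Proof. by rewrite -[X]scale1r w_tensor.1 mul1r scale1r. Qed.

Lemma tensor0l Y : w 0 Y = 0.
Proof. by apply: (addrI (w 0 Y)); rewrite -tensorDl !addr0. Qed.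

Lemma tensorZl u X Y : w (u *: X) Y = u * w X Y.
Proof. by rewrite -[u *: X]addr0 w_tensor.1 tensor0l addr0. Qed.

Lemma tensorNl X Y : w (- X) Y = - w X Y.
Proof. by rewrite -scaleN1r tensorZl mulN1r. Qed.

End Tensors.

Section AffineConnection.
Variables (R : realType) (n : nat) (M : manifoldType R n).
Variable nabla : vfield M -> vfield M -> vfield M.
Hypothesis nabla_affine : affine_connection nabla.
Implicit Types (X Y Z : vfield M) (u : Cinf M).

Lemma connDl X X' Y : nabla (X + X') Y = nabla X Y + nabla X' Y.
Proof.
by case: nabla_affine => nl _ _; rewrite -[X]scale1r nl !scale1r.
Qed.

Lemma conn0l Y : nabla 0 Y = 0.
Proof. by apply: (addrI (nabla 0 Y)); rewrite -connDl !addr0. Qed.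

Lemma connZl u X Y : nabla (u *: X) Y = u *: nabla X Y.
Proof.
by case: nabla_affine => nl _ _; rewrite -[u *: X]addr0 nl conn0l addr0.
Qed.

Lemma connNl X Y : nabla (- X) Y = - nabla X Y.
Proof. by rewrite -scaleN1r connZl scaleN1r. Qed.

Lemma connDr X Y Y' : nabla X (Y + Y') = nabla X Y + nabla X Y'.
Proof. by case: nabla_affine. Qed.

Lemma connZr u X Y : nabla X (u *: Y) = X u *: Y + u *: nabla X Y.
Proof. by case: nabla_affine. Qed.

Lemma conn0r X : nabla X 0 = 0.
Proof. by apply: (addrI (nabla X 0)); rewrite -connDr !addr0. Qed.

Lemma connNr X Y : nabla X (- Y) = - nabla X Y.
Proof. by apply: (addrI (nabla X Y)); rewrite -connDr !subrr conn0r. Qed.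

Lemma curvature_anti X Y Z : curvature nabla X Y Z = - curvature nabla Y X Z.
Proof.
rewrite /curvature (lie_anti X Y) connNl.
by apply: vfieldP => f /=; ring.
Qed.

(** The term [nabla_(lie X Y)] cancels the derivative of [u] that comes out of
    [nabla Y (u *: nabla X Z)]. *)
Lemma curvature_addl u X X' Y Z :
  curvature nabla (u *: X + X') Y Z =
  u *: curvature nabla X Y Z + curvature nabla X' Y Z.
Proof.
rewrite /curvature lieDl lieZl !(connDl, connZl, connNl, connDr, connZr).
by apply: vfieldP => f /=; ring.
Qed.

(** The second derivatives of [u] form the commutator of [X] and [Y] on [u],
    which the term [nabla_(lie X Y)] removes. *)
Lemma curvature_addr u X Y Z Z' :
  curvature nabla X Y (u *: Z + Z') =
  u *: curvature nabla X Y Z + curvature nabla X Y Z'.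
Proof.
rewrite /curvature !(connDr, connZr).
by apply: vfieldP => f /=; ring.
Qed.

Lemma curvature_parallel X Y Z :
  nabla X Z = 0 -> nabla X (nabla Y Z) = 0 -> nabla (lie X Y) Z = 0 ->
  curvature nabla X Y Z = 0.
Proof. by rewrite /curvature => -> -> ->; rewrite conn0r !subr0. Qed.

Lemma conn_cst_comb (a b : R) X Y Y' :
  nabla X Y = 0 -> nabla X Y' = 0 ->
  nabla X (cst_fun M a *: Y + cst_fun M b *: Y') = 0.
Proof.
by move=> XY XY'; rewrite connDr !connZr XY XY' !vf_cst !scale0r !scaler0 !addr0.
Qed.

End AffineConnection.

(** * The Levi-Civita connection in a frame with constant inner products *)

Section LeviCivita.
Variables (R : realType) (n : nat) (M : manifoldType R n).
Variables (g : vfield M -> vfield M -> Cinf M).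
Variables (nabla : vfield M -> vfield M -> vfield M).
Hypothesis g_tensor : tensor02 g.
Hypothesis gC : forall X Y, g X Y = g Y X.
Hypothesis nabla_lc : levi_civita g nabla.
Implicit Types X Y Z : vfield M.

Lemma levi_civita_metric X Y Z : X (g Y Z) = g (nabla X Y) Z + g (nabla X Z) Y.
Proof.
have [_ _ /(_ X Y Z) gXYZ] := nabla_lc; apply/eqP.
by rewrite -subr_eq0 opprD addrA -(gC Y) -[X in _ == X]gXYZ.
Qed.

Lemma levi_civita_torsion X Y Z :
  g (lie X Y) Z = g (nabla X Y) Z - g (nabla Y X) Z.
Proof.
by case: nabla_lc => _ <- _; rewrite (tensorDl g_tensor) (tensorNl g_tensor).
Qed.

Lemma koszul X Y Z :
  g (nabla X Y) Z + g (nabla X Y) Z =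
  X (g Y Z) + Y (g Z X) - Z (g X Y)
  + g (lie X Y) Z - g (lie Y Z) X + g (lie Z X) Y.
Proof. rewrite !levi_civita_metric !levi_civita_torsion; ring. Qed.

Lemma koszul_commuting (I : Type) (E : I -> vfield M) (c : I -> I -> R) :
  (forall i j, lie (E i) (E j) = 0) ->
  (forall i j, g (E i) (E j) = cst_fun M (c i j)) ->
  forall i j k, g (nabla (E i) (E j)) (E k) = 0.
Proof.
move=> lieE gE i j k; apply: Cinf_double_eq0.
rewrite koszul !lieE !gE !vf_cst !(tensor0l g_tensor); ring.
Qed.

Lemma levi_civita_unit X (a : R) : g X X = cst_fun M a -> g (nabla X X) X = 0.
Proof.
by move=> gXX; apply: Cinf_double_eq0; rewrite -levi_civita_metric gXX vf_cst.
Qed.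

End LeviCivita.

(** * Projections onto a distribution and its orthogonal complement *)

Section Splitting.
Variables (R : realType) (n : nat) (M : manifoldType R n).
Variables (e1 e2 e3 : vfield M) (pi pi' : vfield M -> vfield M).
Hypothesis pi_proj : is_projections (span2 e1 e2) (span1 e3) pi pi'.

(** A property stable under combinations over the smooth functions need only be
    checked on the frame; it holds at 0, as [0 = - e1 + e1]. *)
Lemma projections_ind (P : vfield M -> Prop) :
  (forall u X X', P X -> P X' -> P (u *: X + X')) ->
  P e1 -> P e2 -> P e3 -> forall X, P X.
Proof.
move=> PD P1 P2 P3 X; have [[u [v ->]] [t ->] ->] := pi_proj X.
have P0 : P 0 by rewrite -(addNr e1) -scaleN1r; exact: PD.
rewrite -addrA; apply: (PD) => //; apply: (PD) => //.
by rewrite -[_ *: _]addr0; exact: PD.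
Qed.

Variable g : vfield M -> vfield M -> Cinf M.
Hypothesis g_tensor : tensor02 g.
Hypothesis gC : forall X Y, g X Y = g Y X.
Hypothesis g_on : pseudo_orthonormal g e1 e2 e3.

Lemma projection_orthonormal X : pi X = g X e1 *: e1 + g X e2 *: e2.
Proof.
have [[g11 g22 g33] [g12 g13 g23]] := g_on.
have [[u [v piX]] [t pi'X] defX] := pi_proj X.
rewrite {1}piX {}defX {}piX {}pi'X !(tensorDl g_tensor) !(tensorZl g_tensor).
rewrite g11 g22 (gC e2 e1) (gC e3 e1) (gC e3 e2) g12 g13 g23.
by rewrite !(mulr0, mulr1, addr0, add0r).
Qed.

Lemma projection_perp_orthonormal X : pi' X = - g X e3 *: e3.
Proof.
have [[g11 g22 g33] [g12 g13 g23]] := g_on.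
have [[u [v piX]] [t pi'X] defX] := pi_proj X.
rewrite {1}pi'X {}defX {}piX {}pi'X !(tensorDl g_tensor) !(tensorZl g_tensor).
by rewrite g33 g13 g23 !(mulr0, addr0, add0r) mulrN1 opprK.
Qed.

End Splitting.

(** * Flatness of the Bott connection *)

Section BottConnection.
Variables (R : realType) (n : nat) (M : manifoldType R n).
Variables (alpha beta gamma delta : R) (g : vfield M -> vfield M -> Cinf M).
Hypothesis g_tensor : tensor02 g.
Hypothesis gC : forall X Y, g X Y = g Y X.
Variables (e1 e2 e3 : vfield M).
Hypothesis g_on : pseudo_orthonormal g e1 e2 e3.
Hypothesis lie12 : lie e1 e2 = 0.
Hypothesis lie13 : lie e1 e3 = cst_fun M alpha *: e1 + cst_fun M beta *: e2.
Hypothesis lie23 : lie e2 e3 = cst_fun M gamma *: e1 + cst_fun M delta *: e2.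
Variables nablaL nablaB : vfield M -> vfield M -> vfield M.
Hypothesis nablaL_lc : levi_civita g nablaL.
Variables pi pi' : vfield M -> vfield M.
Hypothesis pi_proj : is_projections (span2 e1 e2) (span1 e3) pi pi'.
Hypothesis nablaB_bott :
  bott_connection nablaL (span2 e1 e2) (span1 e3) pi pi' nablaB.
Implicit Types X Y Z : vfield M.

Definition parallel_along_D Z : Prop := nablaB e1 Z = 0 /\ nablaB e2 Z = 0.

Let nablaB_affine : affine_connection nablaB.
Proof. by case: nablaB_bott. Qed.

Let De1 : span2 e1 e2 e1.
Proof. by exists 1, 0; rewrite scale1r scale0r addr0. Qed.

Let De2 : span2 e1 e2 e2.
Proof. by exists 0, 1; rewrite scale1r scale0r add0r. Qed.

Let De3 : span1 e3 e3.
Proof. by exists 1; rewrite scale1r. Qed.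

Let Dlie13 : span2 e1 e2 (lie e1 e3).
Proof. by rewrite lie13; exists (cst_fun M alpha), (cst_fun M beta). Qed.

Let Dlie23 : span2 e1 e2 (lie e2 e3).
Proof. by rewrite lie23; exists (cst_fun M gamma), (cst_fun M delta). Qed.

Let D_opp X : span2 e1 e2 X -> span2 e1 e2 (- X).
Proof. by move=> [u [v ->]]; exists (- u), (- v); rewrite !scaleNr opprD. Qed.

Let D_projection X : span2 e1 e2 X -> pi X = X.
Proof.
have [[g11 g22 _] [g12 _ _]] := g_on.
move=> [u [v ->]]; rewrite (projection_orthonormal pi_proj g_tensor gC g_on).
rewrite !(tensorDl g_tensor) !(tensorZl g_tensor) (gC e2 e1) g11 g22 g12.
by rewrite !(mulr0, mulr1, addr0, add0r).
Qed.

Let D_projection_perp X : span2 e1 e2 X -> pi' X = 0.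
Proof.
move=> /D_projection piX; have [_ _] := pi_proj X.
by rewrite piX => /eqP; rewrite -subr_eq0 opprD addNKr oppr_eq0 => /eqP.
Qed.

(** Indexing [e1] and [e2] by booleans treats the four pairs at once: all
    brackets and all derivatives of inner products in the Koszul formula
    vanish. *)
Lemma bott_D_D (b c : bool) :
  nablaB (if b then e1 else e2) (if c then e1 else e2) = 0.
Proof.
pose E (b : bool) := if b then e1 else e2.
have lieE a a' : lie (E a) (E a') = 0.
  have lie_self X : lie X X = 0 by apply: vfieldP => f /=; exact: subrr.
  by case: a; case: a' => //; rewrite /E lie_anti lie12 oppr0.
have gE a a' : g (E a) (E a') = cst_fun M (a == a')%:R.
  have [[g11 g22 _] [g12 _ _]] := g_on.
  by case: a; case: a'; rewrite /cst_fun /= ?scale1r ?scale0r// gC.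
have ginE := koszul_commuting g_tensor gC nablaL_lc lieE gE.
have DE a : span2 e1 e2 (E a) by case: a.
case: nablaB_bott => _ bott _ _ _; rewrite (bott _ _ (DE b) (DE c)).
rewrite (projection_orthonormal pi_proj g_tensor gC g_on).
by rewrite (ginE b c true) (ginE b c false) !scale0r addr0.
Qed.

Lemma bott_frame_parallel :
  [/\ parallel_along_D e1, parallel_along_D e2 & parallel_along_D e3].
Proof.
split; split.
- exact: (bott_D_D true true).
- exact: (bott_D_D false true).
- exact: (bott_D_D true false).
- exact: (bott_D_D false false).
- by case: nablaB_bott => _ _ _ bott _; rewrite bott// D_projection_perp.
- by case: nablaB_bott => _ _ _ bott _; rewrite bott// D_projection_perp.
Qed.

Lemma bott_e3 :
  [/\ nablaB e3 e1 = - lie e1 e3, nablaB e3 e2 = - lie e2 e3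
    & nablaB e3 e3 = 0].
Proof.
case: nablaB_bott => _ _ bott _ bott3; split.
- by rewrite bott// lie_anti D_projection//; exact: D_opp.
- by rewrite bott// lie_anti D_projection//; exact: D_opp.
have g33 : g e3 e3 = cst_fun M (-1).
  by have [[_ _ ->] _] := g_on; rewrite /cst_fun scaleN1r.
rewrite bott3// (projection_perp_orthonormal pi_proj g_tensor g_on).
by rewrite (levi_civita_unit gC nablaL_lc g33) oppr0 scale0r.
Qed.

(** [nablaB e3] has constant coefficients on the frame, so applying it keeps a
    frame field parallel along [D]. *)
Lemma bott_e3_parallel :
  [/\ parallel_along_D (nablaB e3 e1), parallel_along_D (nablaB e3 e2)
    & parallel_along_D (nablaB e3 e3)].
Proof.
have [[p11 p21] [p12 p22] _] := bott_frame_parallel.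
have [-> -> ->] := bott_e3; rewrite lie13 lie23 /parallel_along_D.
by rewrite !(connNr nablaB_affine) !(conn_cst_comb nablaB_affine)//
  !(conn0r nablaB_affine) oppr0.
Qed.

Lemma parallel_along_D_span X Z :
  parallel_along_D Z -> span2 e1 e2 X -> nablaB X Z = 0.
Proof.
move=> [Z1 Z2] [u [v ->]].
by rewrite (connDl nablaB_affine) !(connZl nablaB_affine) Z1 Z2 !scaler0 addr0.
Qed.

(** For a pair of frame fields, every term of the curvature contains a derivative
    of [Z] or of [nablaB e3 Z] along [D]: the brackets of the frame lie in [D],
    and two frame fields cannot both be transverse to [D] unless they are equal,
    when the curvature vanishes by antisymmetry.  Tensoriality does the rest. *)
Lemma curvature_parallel_along_D X Y Z :
  parallel_along_D Z -> parallel_along_D (nablaB e3 Z) ->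
  curvature nablaB X Y Z = 0.
Proof.
move=> pZ pZ3; have [p1 p2] := pZ; have [p31 p32] := pZ3.
have pD := parallel_along_D_span pZ.
have c12 : curvature nablaB e1 e2 Z = 0.
  apply: (curvature_parallel nablaB_affine) => //.
    by rewrite p2 (conn0r nablaB_affine).
  by rewrite lie12 (conn0l nablaB_affine).
have c13 : curvature nablaB e1 e3 Z = 0.
  by apply: (curvature_parallel nablaB_affine) => //; exact: pD.
have c23 : curvature nablaB e2 e3 Z = 0.
  by apply: (curvature_parallel nablaB_affine) => //; exact: pD.
have anti A B : curvature nablaB A B Z = 0 -> curvature nablaB B A Z = 0.
  by move=> AB; rewrite (curvature_anti nablaB_affine) AB oppr0.
have self A : curvature nablaB A A Z = 0.
  have lieAA : lie A A = 0 by apply: vfieldP => f /=; exact: subrr.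
  by rewrite /curvature lieAA (conn0l nablaB_affine) !subrr.
have ext B : curvature nablaB e1 B Z = 0 -> curvature nablaB e2 B Z = 0 ->
    curvature nablaB e3 B Z = 0 -> forall A, curvature nablaB A B Z = 0.
  move=> B1 B2 B3; apply: (projections_ind pi_proj) => // u A A' A0 A0'.
  by rewrite (curvature_addl nablaB_affine) A0 A0' scaler0 addr0.
have c21 := anti _ _ c12; have c31 := anti _ _ c13; have c32 := anti _ _ c23.
by apply: (ext Y); apply: anti; apply: ext; rewrite ?self.
Qed.

Lemma bott_flat X Y Z : curvature nablaB X Y Z = 0.
Proof.
have [p1 p2 p3] := bott_frame_parallel; have [q1 q2 q3] := bott_e3_parallel.
elim/(projections_ind pi_proj): Z => [u A A' A0 A0'|||].
  by rewrite (curvature_addr nablaB_affine) A0 A0' scaler0 addr0.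
all: exact: curvature_parallel_along_D.
Qed.

End BottConnection.

(** * The Ricci tensor and the Codazzi identity *)

Section FlatRicci.
Variables (R : realType) (n : nat) (M : manifoldType R n).

Lemma sym_ricci_flat (g : vfield M -> vfield M -> Cinf M)
    (nabla : vfield M -> vfield M -> vfield M) (e1 e2 e3 X Y : vfield M) :
  tensor02 g -> (forall X Y Z, curvature nabla X Y Z = 0) ->
  sym_ricci g nabla e1 e2 e3 X Y = 0.
Proof.
move=> g_tensor flat; rewrite /sym_ricci /ricci !flat !(tensor0l g_tensor).
by rewrite !(oppr0, addr0) scaler0.
Qed.

Lemma codazzi_zero (nabla : vfield M -> vfield M -> vfield M)
    (w : vfield M -> vfield M -> Cinf M) :
  (forall X Y, w X Y = 0) -> codazzi_tensor nabla w.
Proof.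
move=> w0; split; first by split=> *; rewrite !w0 mulr0 addr0.
by move=> X Y Z; rewrite /cov_deriv02 !w0 !vf_zero !subr0.
Qed.

End FlatRicci.

Theorem theorem2p16 (R : realType) (alpha beta gamma delta : R)
    (h_trace : alpha + delta != 0)
    (h_rel : alpha * gamma + beta * delta = 0)
    (G : lieGroupType R 3)
    (G_connected : connected [set: G])
    (G_simply_connected : simply_connected R G)
    (g : vfield G -> vfield G -> Cinf G)
    (g_lorentzian : lorentzian_metric g)
    (g_left_invariant : left_invariant_metric g)
    (e1 e2 e3 : vfield G)
    (e_basis : lie_algebra_basis (frame3 e1 e2 e3))
    (e_orthonormal : pseudo_orthonormal g e1 e2 e3)
    (bracket12 : lie e1 e2 = 0)
    (bracket13 : lie e1 e3 = cst_fun G alpha *: e1 + cst_fun G beta *: e2)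
    (bracket23 : lie e2 e3 = cst_fun G gamma *: e1 + cst_fun G delta *: e2)
    (nablaL : vfield G -> vfield G -> vfield G)
    (nablaL_levi_civita : levi_civita g nablaL)
    (piD piDperp : vfield G -> vfield G)
    (pi_projections : is_projections (span2 e1 e2) (span1 e3) piD piDperp)
    (nablaB : vfield G -> vfield G -> vfield G)
    (nablaB_bott :
      bott_connection nablaL (span2 e1 e2) (span1 e3) piD piDperp nablaB) :
  codazzi_tensor nablaB (sym_ricci g nablaB e1 e2 e3).
Proof.
have [g_tensor gC _] := g_lorentzian.
apply: codazzi_zero => X Y; apply: sym_ricci_flat => // A B C.
exact: (bott_flat g_tensor gC e_orthonormal bracket12 bracket13 bracket23
  nablaL_levi_civita pi_projections nablaB_bott).
Qed.
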